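(* Let $\mathcal L=\{L_0,L_\infty,L_1,\ldots,L_r\}$ be a set of pairwise skew lines in $\mathbb P^3_K$, where $L_0=\{(v,0)\}$, $L_\infty=\{(0,v)\}$, and $L_i=\{(v,M_iv)\}$ for $1\le i\le r$, with corresponding matrices $M_0=0$, $M_1=I$, and $M_2,\ldots,M_r\in \mathrm{GL}_2(K)$. For any triple of distinct indices $i,j,k\in\{0,1,\ldots,r,\infty\}$, the map $f_{ijk}:L_i\to L_j$ is represented, under the parametrizations $L_i\simeq\mathbb P(K^2)$, by the element $F_{ijk}\in \mathrm{PGL}_2(K)$ given as follows. (1) If $i,j,k\in\{0,1,\ldots,r\}$, then $F_{ijk}=[(M_j-M_k)^{-1}(M_i-M_k)]$. (2) If one of the three indices is $\infty$ (and the other two lie in $\{0,1,\ldots,r\}$), then $F_{ij\infty}=[I]$, $F_{i\infty k}=[M_i-M_k]$, and $F_{\infty jk}=[(M_j-M_k)^{-1}]$.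
   Context: $K$ is an algebraically closed field and $\mathbb P^3=\mathbb P(K^2\oplus K^2)$; points are written $(u,w)$ with $u,w\in K^2$, not both zero, up to common scaling. Two lines are skew if they are disjoint. Every line skew to both $L_0$ and $L_\infty$ is of the form $\{(v,Mv)\mid v\in K^2\}$ for a unique $M\in\mathrm{GL}_2(K)$, called its corresponding matrix. For three distinct pairwise skew lines $L_i,L_j,L_k$, the map $f_{ijk}:L_i\to L_j$ sends $p\in L_i$ to the unique intersection point of $L_j$ with the plane spanned by $p$ and $L_k$. The parametrizations $\mathbb P(K^2)\simeq L_i$ are $[v]\mapsto (v,M_iv)$ for $i\in\{0,1,\ldots,r\}$ and $[v]\mapsto(0,v)$ for $i=\infty$. For $A\in \mathrm{GL}_2(K)$, $[A]$ denotes its class in $\mathrm{PGL}_2(K)$. *)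

(* Defs.v *)
From HB Require Import structures.
From mathcomp Require Import all_boot all_order all_algebra.

Set Implicit Arguments.
Unset Strict Implicit.
Unset Printing Implicit Defensive.

Import GRing.Theory.
Local Open Scope ring_scope.
Local Open Scope quotient_scope.

(* P(V): the one-dimensional subspaces of V, [v] being the span <[v]>. *)
Definition proj (K : fieldType) (V : vectType K) : Type :=
  {p : {vspace V} | \dim p == 1%N}.

Section ProjMap.
Variables (K : fieldType) (U V : vectType K).

Lemma proj_map_subproof (f : 'Hom(U, V)) (fI : lker f == 0%VS) (x : proj U) :
  \dim (f @: val x)%VS == 1%N.
Proof. by rewrite limg_dim_eq ?(valP x) // (eqP fI) capv0. Qed.

(* The map [v] |-> [f v] for an injective linear map f. *)
Definition proj_map (f : 'Hom(U, V)) (fI : lker f == 0%VS) (x : proj U) :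
  proj V := exist _ (f @: val x)%VS (proj_map_subproof fI x).

End ProjMap.

Section Plane.
Variable K : fieldType.

Definition K2 : vectType K := 'cV[K]_2.

Definition GL2 : Type := {A : 'M[K]_2 | A \in unitmx}.

Definition pgl_rel : rel GL2 :=
  fun A B => is_scalar_mx (val A *m invmx (val B)).

Lemma pgl_relP (A B : GL2) :
  reflect (exists2 c : K, c != 0 & val A = c *: val B) (pgl_rel A B).
Proof.
apply: (iffP is_scalar_mxP) => [[c eAB]|[c _ eAB]].
  have eA : val A = c *: val B.
    by rewrite -mul_scalar_mx -eAB mulmxKV ?(valP B).
  exists c => //; apply: contraTneq (valP A) => c0.
  by rewrite eA c0 scale0r unitmxE det0 unitr0.
by exists c; rewrite eAB -scalemxAl mulmxV ?(valP B) // scalemx1.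
Qed.

Lemma pgl_rel_refl : reflexive pgl_rel.
Proof. by move=> A; apply/pgl_relP; exists 1; rewrite ?oner_neq0 ?scale1r. Qed.

Lemma pgl_rel_sym : symmetric pgl_rel.
Proof.
suff s A B : pgl_rel A B -> pgl_rel B A by move=> A B; apply/idP/idP; apply: s.
move=> /pgl_relP[c c0 eAB]; apply/pgl_relP; exists c^-1; rewrite ?invr_eq0 //.
by rewrite eAB scalerA mulVf // scale1r.
Qed.

Lemma pgl_rel_trans : transitive pgl_rel.
Proof.
move=> B A C /pgl_relP[c c0 eAB] /pgl_relP[d d0 eBC]; apply/pgl_relP.
by exists (c * d); rewrite ?mulf_neq0 // eAB eBC scalerA.
Qed.

Canonical pgl_equiv := EquivRel pgl_rel pgl_rel_refl pgl_rel_sym pgl_rel_trans.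

Definition PGL2 := {eq_quot pgl_equiv}.

Definition pgl_class (A : GL2) : PGL2 := \pi_PGL2 A.

Lemma pgl_classP (A B : GL2) :
  reflect (exists2 c : K, c != 0 & val A = c *: val B)
          (pgl_class A == pgl_class B).
Proof.
apply: (iffP eqP) => [/eqmodP/pgl_relP // | eAB].
by apply/eqmodP/pgl_relP.
Qed.

Definition gl_hom (A : GL2) : 'Hom(K2, K2) :=
  linfun (mulmx (val A) : 'cV[K]_2 -> 'cV[K]_2).

Lemma gl_hom_inj (A : GL2) : lker (gl_hom A) == 0%VS.
Proof.
by apply/lker0P => u v; rewrite !lfunE; apply: (can_inj (mulKmx (valP A))).
Qed.

Definition gl_act (A : GL2) : proj K2 -> proj K2 := proj_map (gl_hom_inj A).

(* Independent of the representative, see pgl_act_class. *)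
Definition pgl_act (F : PGL2) : proj K2 -> proj K2 := gl_act (repr F).

Lemma pgl_act_class (A : GL2) : pgl_act (pgl_class A) =1 gl_act A.
Proof.
have /pgl_classP[c c0 eA] : pgl_class (repr (pgl_class A)) == pgl_class A.
  by rewrite /pgl_class reprK.
move=> x; apply: val_inj => /=.
have {}eA : gl_hom (repr (pgl_class A)) = c *: gl_hom A.
  by apply/lfunP => v; rewrite scale_lfunE !lfunE /= eA -scalemxAl.
rewrite /= eA; apply/vspaceP => w; apply/memv_imgP/memv_imgP => -[v vx ->].
  by exists (c *: v); rewrite ?memvZ // scale_lfunE linearZ.
exists (c^-1 *: v); rewrite ?memvZ //.
by rewrite scale_lfunE linearZ /= scalerA mulfV // scale1r.
Qed.

End Plane.

Section Space.
Variable K : fieldType.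

Definition K4 : vectType K := ('cV[K]_2 * 'cV[K]_2)%type.

Definition line : Type := {L : {vspace K4} | \dim L == 2%N}.

Definition on_line (L : line) : pred (proj K4) :=
  fun p => (val p <= val L)%VS.

Definition points (L : line) : Type := {p : proj K4 | on_line L p}.

Definition skew (L L' : line) : Prop :=
  forall p : proj K4, ~ (on_line L p /\ on_line L' p).

Lemma skewP (L L' : line) : skew L L' <-> (val L :&: val L' = 0)%VS.
Proof.
split=> [sk | cap0 p [pL pL']].
  apply/eqP; apply/negPn/negP => /eqP n0; pose v := vpick (val L :&: val L').
  have v0 : v != 0 by rewrite vpick0; apply/eqP.
  have d1 : \dim <[v]> == 1%N by rewrite dim_vline v0.
  apply: (sk (exist _ <[v]>%VS d1)); rewrite /on_line /=.
  by apply/andP; rewrite -subv_cap -memvE memv_pick.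
have := valP p; have : (val p <= val L :&: val L')%VS by rewrite subv_cap; apply/andP.
by rewrite cap0 subv0 => /eqP->; rewrite dimv0.
Qed.

Definition pairwise_skew (I : eqType) (L : I -> line) : Prop :=
  forall i j, i != j -> skew (L i) (L j).

Definition skew_triple (Li Lj Lk : line) : Prop :=
  [/\ skew Li Lj, skew Li Lk & skew Lj Lk].

Lemma transversal_point_subproof (Li Lj Lk : line) :
  skew_triple Li Lj Lk -> forall p : points Li,
  \dim (val Lj :&: (val (val p) + val Lk))%VS == 1%N.
Proof.
case=> _ /skewP ik /skewP jk p.
have dLj := eqP (valP Lj); have dLk := eqP (valP Lk).
have dp := eqP (valP (val p)).
have dV : \dim {:K4} = 4 by rewrite dimvf.
have djk : \dim (val Lj + val Lk)%VS = 4.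
  by have := dimv_sum_cap (val Lj) (val Lk); rewrite jk dimv0 dLj dLk addn0.
have pk : (val (val p) :&: val Lk = 0)%VS.
  by apply/eqP; rewrite -subv0 -ik capvS //; exact: (valP p).
have dpk : \dim (val (val p) + val Lk)%VS = 3.
  by have := dimv_sum_cap (val (val p)) (val Lk); rewrite pk dimv0 dp dLk addn0.
have dS : \dim (val Lj + (val (val p) + val Lk))%VS = 4.
  apply/eqP; rewrite eqn_leq -{1}dV dimvS ?subvf //= -djk dimvS //.
  by rewrite addvS // addvSr.
have := dimv_sum_cap (val Lj) (val (val p) + val Lk).
by rewrite dS dLj dpk => /eqP; rewrite (eqn_add2l 4 _ 1).
Qed.

Definition transversal_point (Li Lj Lk : line) (sk : skew_triple Li Lj Lk)
    (p : points Li) : proj K4 :=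
  exist _ (val Lj :&: (val (val p) + val Lk))%VS
          (transversal_point_subproof sk p).

Lemma transversal_point_on (Li Lj Lk : line) (sk : skew_triple Li Lj Lk)
    (p : points Li) : on_line Lj (transversal_point sk p).
Proof. exact: capvSl. Qed.

(* The map Li -> Lj sending p to the point where Lj meets the plane spanned
   by p and Lk. *)
Definition projection_from (Li Lj Lk : line) (sk : skew_triple Li Lj Lk)
    (p : points Li) : points Lj :=
  exist _ (transversal_point sk p) (transversal_point_on sk p).

Lemma projection_fromP (Li Lj Lk : line) (sk : skew_triple Li Lj Lk)
    (p : points Li) (q : points Lj) :
  (val (val q) <= val (val p) + val Lk)%VS <-> q = projection_from sk p.
Proof.
split=> [qpk | ->]; last exact: capvSr.
apply/val_inj/val_inj/eqP; rewrite eqEdim subv_cap [(_ <= val Lj)%VS](valP q).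
rewrite qpk /= (eqP (valP (val q))).
by rewrite (eqP (transversal_point_subproof sk p)).
Qed.

Lemma pairwise_skew_triple (I : eqType) (L : I -> line) (i j k : I) :
  pairwise_skew L -> uniq [:: i; j; k] -> skew_triple (L i) (L j) (L k).
Proof.
move=> sk /=; rewrite !inE negb_or => /and3P[/andP[ij ik] jk _].
by split; apply: sk.
Qed.

Definition fmap (I : eqType) (L : I -> line) (sk : pairwise_skew L)
    (i j k : I) (d : uniq [:: i; j; k]) : points (L i) -> points (L j) :=
  projection_from (pairwise_skew_triple sk d).

End Space.

Section Configuration.
Variables (K : fieldType) (r : nat) (M : 'I_r.+1 -> 'M[K]_2).

(* The index set {0, 1, ..., r, oo}: Some i stands for i, None for oo. *)
Definition index : Type := option 'I_r.+1.

Definition param_fun (i : index) (v : 'cV[K]_2) : 'cV[K]_2 * 'cV[K]_2 :=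
  if i is Some i' then (v, M i' *m v) else (0, v).

Lemma param_fun_is_linear (i : index) :
  linear (param_fun i : 'cV[K]_2 -> K4 K).
Proof.
case: i => [i|] a u v /=; congr pair.
  by rewrite mulmxDr -scalemxAr.
by rewrite /= scaler0 addr0.
Qed.

HB.instance Definition _ (i : index) :=
  GRing.isLinear.Build K (K2 K) (K4 K) *:%R (param_fun i)
    (param_fun_is_linear i).

Definition param_hom (i : index) : 'Hom(K2 K, K4 K) := linfun (param_fun i).

Lemma param_homE (i : index) v : param_hom i v = param_fun i v.
Proof. exact: lfunE. Qed.

Lemma param_hom_inj (i : index) : lker (param_hom i) == 0%VS.
Proof.
by apply/lker0P => u v; rewrite !param_homE; case: i => [i|] /= [] // ->.
Qed.

Lemma config_line_subproof (i : index) : \dim (limg (param_hom i)) == 2%N.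
Proof. by rewrite limg_dim_eq ?dimvf // (eqP (param_hom_inj i)) capv0. Qed.

(* L_i = {(v, M_i v)} for i <= r, and L_oo = {(0, v)}. *)
Definition config_line (i : index) : line K :=
  exist _ (limg (param_hom i)) (config_line_subproof i).

Lemma param_on (i : index) (x : proj (K2 K)) :
  on_line (config_line i) (proj_map (param_hom_inj i) x).
Proof. by rewrite /on_line /= limgS ?subvf. Qed.

(* The parametrization [v] |-> [(v, M_i v)], resp. [v] |-> [(0, v)]. *)
Definition param (i : index) (x : proj (K2 K)) : points (config_line i) :=
  exist _ (proj_map (param_hom_inj i) x) (param_on i x).

Definition represents (i j : index)
    (f : points (config_line i) -> points (config_line j)) (F : PGL2 K) : Prop :=
  forall x : proj (K2 K), f (param i x) = param j (pgl_act F x).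

End Configuration.

(* Main.v *)
(* If (A v)_j = v_i + w_k, where v_i is the image of v under the i-th linear
   parametrization, then [(A v)_j] lies on L_j and on the plane spanned by
   [v_i] and L_k, so it is the image of [v_i] under f_ijk.  Comparing
   the two coordinates determines w and gives the formula for A.
   The differences M_i - M_k are invertible because a nonzero v in the kernel
   would give a common point [(v, M_i v)] of L_i and L_k. *)
Require Import Defs.
From mathcomp Require Import all_boot all_order all_algebra.
Import GRing.Theory.
Local Open Scope ring_scope.

Lemma skew_unitmx (K : fieldType) (r : nat) (M : 'I_r.+1 -> 'M[K]_2)
    (i k : 'I_r.+1) :
  Defs.skew (config_line M (Some i)) (config_line M (Some k)) ->
  M i - M k \in unitmx.
Proof.
(* [det0P] yields a row vector killed from the left, so the determinant is transposed first and
   [v^T] is the kernel vector. *)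
move=> /skewP cap0; rewrite unitmxE unitfE -det_tr; apply/det0P => -[v v0 vM].
have Mv : M i *m v^T = M k *m v^T.
  by apply/eqP; rewrite -subr_eq0 -mulmxBl -[_ *m _]trmxK trmx_mul trmxK vM trmx0.
have : param_hom M (Some i) v^T == 0.
  rewrite -memv0 -cap0 memv_cap memv_img ?memvf //=.
  have -> : param_hom M (Some i) v^T = param_hom M (Some k) v^T.
    by rewrite !param_homE /= Mv.
  by rewrite memv_img ?memvf.
rewrite param_homE => /eqP[/eqP].
by rewrite trmx_eq0 (negPf v0).
Qed.

Lemma represents_transversal (K : fieldType) (r : nat)
    (M : 'I_r.+1 -> 'M[K]_2) (sk : pairwise_skew (config_line M))
    (i j k : Defs.index r) (d : uniq [:: i; j; k]) (A : 'M[K]_2) :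
  A \in unitmx ->
  (forall v, exists w,
     param_fun M j (A *m v) = param_fun M i v + param_fun M k w) ->
  exists2 B : GL2 K, val B = A & represents (fmap sk d) (pgl_class B).
Proof.
move=> AU Av; pose B : GL2 K := exist _ A AU.
(* By uniqueness of the intersection point, it suffices that the candidate lies in the span of the
   source point and [L_k]. *)
exists B => // x; symmetry; apply/projection_fromP => /=.
have /(congr1 val)/= -> := pgl_act_class B x.
apply/subvP => _ /memv_imgP[_ /memv_imgP[v xv ->] ->].
have -> : gl_hom B v = A *m v by rewrite lfunE.
have [w] := Av v; rewrite -!param_homE => ->.
by rewrite memv_add ?memv_img ?memvf.
Qed.

Theorem lemma2p5 (K : closedFieldType) (r : nat) (M : 'I_r.+1 -> 'M[K]_2)
    (M0 : M ord0 = 0)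
    (M1 : forall i : 'I_r.+1, i = 1%N :> nat -> M i = 1%:M)
    (MGL : forall i : 'I_r.+1, (2 <= i)%N -> M i \in unitmx)
    (Lskew : pairwise_skew (config_line M)) :
  [/\ forall (i j k : 'I_r.+1) (d : uniq [:: Some i; Some j; Some k]),
        exists2 A : GL2 K, val A = invmx (M j - M k) *m (M i - M k)
                         & represents (fmap Lskew d) (pgl_class A),
      forall (i j : 'I_r.+1) (d : uniq [:: Some i; Some j; None]),
        exists2 A : GL2 K, val A = 1%:M
                         & represents (fmap Lskew d) (pgl_class A),
      forall (i k : 'I_r.+1) (d : uniq [:: Some i; None; Some k]),
        exists2 A : GL2 K, val A = M i - M k
                         & represents (fmap Lskew d) (pgl_class A)
    & forall (j k : 'I_r.+1) (d : uniq [:: None; Some j; Some k]),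
        exists2 A : GL2 K, val A = invmx (M j - M k)
                         & represents (fmap Lskew d) (pgl_class A)].
Proof.
have MU (i k : 'I_r.+1) : Some i != Some k -> M i - M k \in unitmx.
  by move=> ik; apply: skew_unitmx; apply: Lskew.
have distinct (i j k : Defs.index r) :
    uniq [:: i; j; k] -> [/\ i != j, i != k & j != k].
  by rewrite /= !inE negb_or => /and3P[/andP[]].
split=> [i j k | i j | i k | j k] d; have [ij ik jk] := distinct _ _ _ d.
- apply: represents_transversal => [|v /=].
    by rewrite unitmx_mul unitmx_inv !MU.
  set A := _ *m (M i - M k); have eA : M j *m A = M i - M k + M k *m A.
    by apply/eqP; rewrite -subr_eq -mulmxBl mulKVmx ?MU.
  (* The first coordinate [A v = v + w] forces [w]; the second is then [eA] applied to [v]. *)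
  exists (A *m v - v); congr pair; first by rewrite /= addrC subrK.
  by rewrite /= mulmxA eA mulmxDl mulmxBl mulmxBr -(mulmxA (M k)) addrAC addrA.
- apply: represents_transversal => [|v /=]; first exact: unitmx1.
  (* Points of [L_oo] have first coordinate 0, so [w] only corrects the second. *)
  exists (M j *m v - M i *m v).
  by rewrite mul1mx; congr pair; rewrite /= ?addr0 // addrC subrK.
- apply: represents_transversal => [|v /=]; first exact: MU.
  (* The target lies on [L_oo], so [w] must cancel the first coordinate [v]. *)
  exists (- v); congr pair; first by rewrite /= subrr.
  by rewrite /= mulmxBl mulmxN.
- apply: represents_transversal => [|v /=]; first by rewrite unitmx_inv MU.
  (* The source has first coordinate 0, hence [w = A v]; what remains is [(M_j - M_k) A v = v]. *)
  exists (invmx (M j - M k) *m v); congr pair; rewrite /= ?add0r //.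
  by apply/eqP; rewrite -subr_eq -mulmxBl mulKVmx ?MU.
Qed.
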